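(* Let $\mathfrak{X}=(X,C)$ be a homogeneous coherent configuration, $D$ a closed subset of $C$, and $\varphi$ an irreducible character of $D$ of multiplicity one. Let $e_\varphi\in\mathbb{C}D\subset M_X(\mathbb{C})$ be the central primitive idempotent of $\mathbb{C}D$ corresponding to $\varphi$, let $\Gamma:e_\varphi\,\mathbb{C}C\,e_\varphi\to M_{X/D}(\mathbb{C})$ be the algebra homomorphism defined in the context, choose representatives $c_\lambda\in C$ ($\lambda\in\Lambda$) such that $C/\!/D=\{c_\lambda^D\mid\lambda\in\Lambda\}$, $c_\lambda^D\neq c_{\lambda'}^D$ for $\lambda\neq\lambda'$, and such that $e_\varphi A_{c_\lambda}e_\varphi\neq 0$ whenever some $c\in C$ with $c^D=c_\lambda^D$ satisfies $e_\varphi A_ce_\varphi\neq 0$. Then $$W=\sum_{\lambda\in\Lambda}\Gamma(e_\varphi A_{c_\lambda}e_\varphi)\in M_{X/D}(\mathbb{C})$$ is a weight on the factor homogeneous coherent configuration $(X/D,C/\!/D)$.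
   Context: For a finite set $X$, $M_X(\mathbb{C})$ is the algebra of complex matrices with rows and columns indexed by $X$. For $c\subset X\times X$, $A_c$ is its $0/1$ adjacency matrix and $c^*=\{(y,x)\mid(x,y)\in c\}$. A homogeneous coherent configuration is a pair $\mathfrak{X}=(X,C)$ where $C$ is a partition of $X\times X$ into non-empty subsets, $c\in C$ implies $c^*\in C$, the diagonal $\{(x,x)\mid x\in X\}$ belongs to $C$, and $\mathbb{C}C=\bigoplus_{c\in C}\mathbb{C}A_c$ is an algebra (the adjacency algebra; it is semisimple). A weight on $\mathfrak{X}=(X,C)$ is a matrix $W\in M_X(\mathbb{C})$ such that, with $\mathrm{spt}(W)=\{(x,y)\mid W_{xy}\neq0\}$ and $A_c^W=A_c\circ W$ (entrywise product): (W1) $\mathrm{spt}(W)$ is a union of members of $C$, and for $d\in C$, $d\subset\mathrm{spt}(W)$ implies $d^*\subset\mathrm{spt}(W)$; (W2) $W_{xx}\neq0$ for all $x\in X$; (W3) the linear span $\bigoplus_{c\in C}\mathbb{C}A_c^W$ is an algebra (closed under matrix multiplication). A (non-empty) subset $D\subset C$ is closed if $\mathbb{C}D=\bigoplus_{d\in D}\mathbb{C}A_d$ is a subalgebra of $\mathbb{C}C$. For $x\in X$ put $xD=\{y\in X\mid(x,y)\in d\text{ for some }d\in D\}$; these sets partition $X$ as $X=x_1D\cup\dots\cup x_mD$, and all have the same size $\ell$. Put $X/D=\{x_1D,\dots,x_mD\}$, $c^D=\{(x_iD,x_jD)\mid c\cap(x_iD\times x_jD)\neq\emptyset\}$ for $c\in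 C$, and $C/\!/D=\{c^D\mid c\in C\}$. Then $(X/D,C/\!/D)$ is a homogeneous coherent configuration, the factor homogeneous coherent configuration. For each $i$, $(x_iD,\{d\cap(x_iD\times x_iD)\mid d\in D\})$ is a homogeneous coherent configuration whose adjacency algebra is isomorphic to $\mathbb{C}D$ via restriction to the block $x_iD$. An irreducible character of $D$ is an irreducible character $\varphi$ of the algebra $\mathbb{C}D$; its multiplicity $m_\varphi$ is its multiplicity in the character of the standard module $\mathbb{C}(x_iD)$ (independent of $i$). Assume $m_\varphi=1$. Then, as an element of $M_X(\mathbb{C})$, $e_\varphi$ is block diagonal with respect to $X=x_1D\cup\dots\cup x_mD$, and its diagonal blocks have rank one. As in the paper, the elements of each $x_iD$ are ordered (each $x_iD$ is identified with $\{1,\dots,\ell\}$) in such a way that all diagonal blocks of $e_\varphi$ are one and the same matrix $e\in M_\ell(\mathbb{C})$; such orderings exist by a known theorem of Hirasaka and Muzychuk. Since $eM_\ell(\mathbb{C})e=\mathbb{C}e$, every element of $e_\varphi\,\mathbb{C}C\,e_\varphi$ has the block form $(a_{ij}e)_{1\le i,j\le m}$ with $a_{ij}\in\mathbb{C}$, and $\Gamma:e_\varphi\,\mathbb{C}C\,e_\varphi\to M_{X/D}(\mathbb{C})$ is the algebra homomorphism sending it to the matrix with $(x_iD,x_jD)$-entry $a_{ij}$. *)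

(* Defs.v *)
From mathcomp Require Import boolp classical_sets reals.
From mathcomp Require Import complex.
From mathcomp Require Import all_boot all_order all_algebra.

Set Implicit Arguments.
Unset Strict Implicit.
Unset Printing Implicit Defensive.

Import GRing.Theory.
Local Open Scope ring_scope.

(* A matrix with rows and columns indexed by a finite type [X] is an element *)
(* of ['M_#|X|], its [(x, y)]-entry being read through [enum_rank].          *)
Notation "''MX' [ F ]_ X" := 'M[F]_#|X|
  (at level 8, X at level 2, format "''MX' [ F ]_ X") : type_scope.

Definition entry (F : fieldType) (X : finType) (A : 'MX[F]_X) (x y : X) : F :=
  A (enum_rank x) (enum_rank y).

Definition adjmx (F : fieldType) (X : finType) (c : {set X * X}) : 'MX[F]_X :=
  \matrix_(i, j) ((enum_val i, enum_val j) \in c)%:R.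

Definition mul_closed (F : fieldType) (n : nat) (V : {vspace 'M[F]_n}) : Prop :=
  {in V &, forall A B, A *m B \in V}.

Section Configurations.
Variables (F : fieldType) (X : finType).
Implicit Types (c d : {set X * X}) (C D : {set {set X * X}}) (W : 'MX[F]_X).

Definition transp c : {set X * X} := [set p | (p.2, p.1) \in c].

Definition diagonal : {set X * X} := [set p | p.1 == p.2].

Definition adj_span C : {vspace 'MX[F]_X} :=
  <<[seq adjmx F c | c <- enum C]>>%VS.

Definition homogeneous_cc C : Prop :=
  [/\ partition C [set: X * X],
      {in C, forall c, transp c \in C},
      diagonal \in C
    & mul_closed (adj_span C)].

Definition closed_subset C D : Prop :=
  [/\ D != set0, D \subset C & mul_closed (adj_span D)].

Definition spt W : {set X * X} := [set p | entry W p.1 p.2 != 0].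

Definition wadjmx W c : 'MX[F]_X := map2_mx *%R (adjmx F c) W.

Definition wadj_span C W : {vspace 'MX[F]_X} :=
  <<[seq wadjmx W c | c <- enum C]>>%VS.

Definition weight C W : Prop :=
  [/\ homogeneous_cc C,
      (exists2 S : {set {set X * X}}, S \subset C & spt W = cover S) /\
        {in C, forall d, d \subset spt W -> transp d \subset spt W},
      forall x : X, entry W x x != 0
    & mul_closed (wadj_span C W)].

Definition block_of D (x : X) : {set X} := [set y | [exists d in D, (x, y) \in d]].

Definition blocks D : {set {set X}} := [set block_of D x | x : X].

Definition factor_pts D : finType := {B : {set X} | B \in blocks D}.

Definition factor_rel D c : {set factor_pts D * factor_pts D} :=
  [set p : factor_pts D * factor_pts D |
     [exists x in val p.1, exists y in val p.2, (x, y) \in c]].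

Definition factor_cc C D : {set {set factor_pts D * factor_pts D}} :=
  [set factor_rel D c | c in C].

End Configurations.

Arguments adj_span F {X} C.
Arguments homogeneous_cc F {X} C.
Arguments closed_subset F {X} C D.

(* Functions on a subalgebra [V] of ['M_n] (representations, characters) are *)
(* total functions on ['M_n] of which only the values on [V] are relevant.   *)
Section Characters.
Variables (F : fieldType) (n : nat) (V : {vspace 'M[F]_n}).
Implicit Types (phi psi chi : 'M[F]_n -> F) (e f : 'M[F]_n).

Definition alg_repr k (rho : 'M[F]_n -> 'M[F]_k) : Prop :=
  [/\ forall a, {in V &, forall A B, rho (a *: A + B) = a *: rho A + rho B},
      {in V &, forall A B, rho (A *m B) = rho A *m rho B}
    & rho 1%:M = 1%:M].

(* Irreducibility is expressed on row vectors, as for [mx_irreducible].       *)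
Definition irr_repr k (rho : 'M[F]_n -> 'M[F]_k) : Prop :=
  [/\ alg_repr rho, (0 < k)%N
    & forall U : 'M[F]_k,
        {in V, forall A, stablemx U (rho A)} -> U = 0 \/ row_full U].

Definition irr_char phi : Prop :=
  exists k (rho : 'M[F]_n -> 'M[F]_k),
    irr_repr rho /\ {in V, forall A, phi A = \tr (rho A)}.

Definition char_multiplicity chi phi (m : nat) : Prop :=
  exists r (psi : 'I_r -> 'M[F]_n -> F),
    [/\ forall i, irr_char (psi i),
        {in V, forall A, chi A = \sum_i psi i A}
      & #|[set i | `[< {in V, psi i =1 phi} >]]| = m].

Definition central_idempotent e : Prop :=
  [/\ e \in V, {in V, forall A, e *m A = A *m e} & e *m e = e].

Definition central_primitive_idempotent e : Prop :=
  [/\ central_idempotent e, e != 0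
    & forall f, central_idempotent f -> e *m f = f -> f = 0 \/ f = e].

(* An idempotent is the identity on the module affording [phi] exactly when  *)
(* [phi] takes its degree there (in characteristic zero).                    *)
Definition central_primitive_idempotent_of phi e : Prop :=
  central_primitive_idempotent e /\ phi e = phi 1%:M.

End Characters.

Section Factor.
Variables (F : fieldType) (X : finType) (D : {set {set X * X}}).

(* The character of the standard module on the points of a block.            *)
Definition std_char (B : {set X}) (A : 'MX[F]_X) : F := \sum_(x in B) entry A x x.

Definition irr_multiplicity (phi : 'MX[F]_X -> F) (m : nat) : Prop :=
  forall B, B \in blocks D ->
    char_multiplicity (adj_span F D) (std_char B) phi m.

Section Ordering.
Variables (l : nat) (o : factor_pts D -> 'I_l -> X).

Definition block_ordering : Prop :=
  forall B, injective (o B) /\ [set o B i | i : 'I_l] = val B.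

Definition mxblock_at (A : 'MX[F]_X) (B B' : factor_pts D) : 'M[F]_l :=
  \matrix_(i, j) entry A (o B i) (o B' j).

(* Meaningful when each block of [A] is a scalar multiple of a fixed [e != 0]; *)
(* the scalar is then unique.                                                  *)
Definition Gamma (e : 'M[F]_l) (A : 'MX[F]_X) : 'MX[F]_(factor_pts D) :=
  \matrix_(p, q)
    xget 0 [set a | mxblock_at A (enum_val p) (enum_val q) = a *: e]%classic.

End Ordering.

Definition class_representatives (C : {set {set X * X}}) (e : 'MX[F]_X)
    (L : finType) (c : L -> {set X * X}) : Prop :=
  [/\ forall i, c i \in C,
      [set factor_rel D (c i) | i : L] = factor_cc C D,
      injective (fun i => factor_rel D (c i))
    & forall i b, b \in C -> factor_rel D b = factor_rel D (c i) ->
        e *m adjmx F b *m e != 0 -> e *m adjmx F (c i) *m e != 0].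

End Factor.

(* Main.v *)
(* Write [V] for the span of [D] and [E] for [e_phi]. The row of a point gives an *)
(* embedding of [V] into each block module, so the right ideal [E V] has        *)
(* dimension at most the rank of a block of [E]. Multiplicity one makes that    *)
(* rank the degree [k] of [phi], whereas irreducibility forces [dim E V >= k];  *)
(* equality makes every nonzero element of [E V] act invertibly, hence [E V] is *)
(* a line, [k = 1] and [e] has rank one.                                        *)
(* The blocks of [E M E] are then scalar multiples of [e], and taking their     *)
(* traces is multiplicative. As [E A_c E] is constant on the members of [C],    *)
(* and each of these meets all blocks of its factor relation, two blocks in the *)
(* same factor relation have traces in a ratio that does not depend on [c].     *)
(* This gives the support condition, and shows that the weighted adjacency      *)
(* matrices span the image of [E (span C) E], which is an algebra.              *)
Require Import Defs.
From mathcomp Require Import boolp classical_sets reals.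
From mathcomp Require Import complex.
From mathcomp Require Import all_boot all_order all_algebra.

Set Implicit Arguments.
Unset Strict Implicit.
Unset Printing Implicit Defensive.

Import Order.TTheory GRing.Theory Num.Theory.
Local Open Scope ring_scope.

Local Notation "A ^H" := (map_mx Num.conj A^T) (at level 1, format "A ^H").

(** Everything is read off the corners [E M E]. By [block_rank1] the common block [e] is an
    idempotent of rank one, so each block of a corner is its trace times [e]; hence [Gamma] takes
    block traces ([Gamma_corner]) and is multiplicative ([block_trace_mul]). Rank one rests on
    semisimplicity of the span of [D], which enters through the positive form tr(A B^H): two-sided
    ideals have central units ([ideal_unit]), so constituents other than [phi] vanish at [E]
    ([char_at_idempotent]), and the dimension count of [irr_degree1] applies.

    The other pillar is [corner_proportional]: within one factor relation, the block traces of a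
    corner at two pairs have a ratio independent of the corner. So the weight vanishes everywhere or
    nowhere on a factor relation ([entry_W_neq0]), and each member of [C] contributes a multiple of
    what its representative does ([block_trace_in_wspan]). The support is closed under transposition
    because [E] is self-adjoint, the diagonal is nonzero because the corner of the identity is [E],
    and the span is an algebra because corners multiply to corners. *)

Lemma vsum_vbasis (F : fieldType) (vT : vectType F) (U : {vspace vT}) (a : 'rV[F]_(\dim U)) :
  \sum_i a 0 i *: (vbasis U)`_i \in U.
Proof.
by apply: memv_suml => i _; apply: rpredZ; apply: vbasis_mem; apply: mem_nth; rewrite size_tuple.
Qed.

Lemma vbasis_nth_mem (F : fieldType) (vT : vectType F) (U : {vspace vT}) (i : 'I_(\dim U)) :
  (vbasis U)`_i \in U.
Proof. by apply: vbasis_mem; apply: mem_nth; rewrite size_tuple. Qed.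

Lemma vbasis_sum_eq0 (F : fieldType) (vT : vectType F) (U : {vspace vT}) (a : 'rV[F]_(\dim U)) :
  \sum_i a 0 i *: (vbasis U)`_i = 0 -> a = 0.
Proof.
move=> a0; apply/rowP => j; rewrite mxE.
by move/freeP: (basis_free (vbasisP U)) => /(_ (a 0)); apply.
Qed.

(** In the full rank factorization e = c d, cancelling c on the left and d on the right of c d c d =
    c d leaves d c = 1. *)
Lemma idempotent_base (F : fieldType) n (e : 'M[F]_n) :
  e *m e = e -> row_base e *m col_base e = 1%:M.
Proof.
have/row_fullP [B hB] := col_base_full e.
have/row_freeP [B' hB'] := row_base_free e.
rewrite -{1 2 3}(mulmx_base e); move: (row_base e) (col_base e) B B' hB hB'.
move=> d c B B' Bc dB' /(congr1 (fun M => B *m M *m B')).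
by rewrite !mulmxA Bc !mul1mx -!mulmxA dB' mulmx1.
Qed.

(** With e = u v and v u = 1, the product e M e is u (v M u) v, and the scalar v M u is its
    trace. *)
Lemma rank1_corner (F : fieldType) n (e : 'M[F]_n) :
  e *m e = e -> \rank e = 1%N -> forall M, e *m M *m e = \tr (e *m M *m e) *: e.
Proof.
move=> ee r1 M.
have [u [v [-> vu]]] : exists (u : 'cV_n) (v : 'rV_n), e = u *m v /\ v *m u = 1%:M.
  have := mulmx_base e; have := idempotent_base ee.
  by move: (row_base e) (col_base e); rewrite r1 => v u vu uv; exists u, v.
have -> : u *m v *m M *m (u *m v) = (v *m M *m u) 0 0 *: (u *m v).
  rewrite scalemxAr -mul_scalar_mx -mx11_scalar.
  by rewrite !mulmxA.
by rewrite mxtraceZ mxtrace_mulC vu mxtrace1 mulr1.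
Qed.

(** * Self-adjoint matrix algebras *)

Section HermitianForm.
Variable C : numClosedFieldType.

Lemma mulmx_adj m n p (A : 'M[C]_(m, n)) (B : 'M[C]_(n, p)) : (A *m B)^H = B^H *m A^H.
Proof. by rewrite trmx_mul map_mxM. Qed.

Lemma adjK m n (A : 'M[C]_(m, n)) : A^H^H = A.
Proof. by apply/matrixP => i j; rewrite !mxE conjCK. Qed.

Lemma mxtrace_adj_eq0 n (A : 'M[C]_n) : \tr (A *m A^H) = 0 -> A = 0.
Proof.
move=> h; apply/matrixP => i j; rewrite mxE.
have ge0 p q : 0 <= A p q * (A^H) q p by rewrite !mxE mul_conjC_ge0.
move: h; rewrite /mxtrace; under eq_bigr do rewrite mxE.
move/eqP; rewrite psumr_eq0 => [/allP /(_ i (mem_index_enum _))|k _]; last first.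
  by apply: sumr_ge0.
rewrite psumr_eq0 // => /allP /(_ j (mem_index_enum _)).
by rewrite !mxE mul_conjC_eq0 => /eqP.
Qed.

(** The Gram matrix [G] of a basis is invertible: a row in its kernel gives an element of [K]
    orthogonal to [K], which positivity kills. *)
Lemma orthogonal_projection n (K : {vspace 'M[C]_n}) (M : 'M[C]_n) :
  exists2 f, f \in K & {in K, forall k, \tr ((M - f) *m k^H) = 0}.
Proof.
pose b (i : 'I_(\dim K)) : 'M[C]_n := (vbasis K)`_i.
pose G := \matrix_(i, j) \tr (b i *m (b j)^H).
have tr0 A : (forall j, \tr (A *m (b j)^H) = 0) -> {in K, forall k, \tr (A *m k^H) = 0}.
  move=> h k /coord_vbasis ->; rewrite linear_sum /= map_mx_sum mulmx_sumr.
  rewrite linear_sum big1 // => j _.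
  rewrite linearZ /= map_mxZ -scalemxAr.
  by rewrite linearZ /= h mulr0.
have sumG (a : 'rV_(\dim K)) j : (a *m G) 0 j = \tr ((\sum_i a 0 i *: b i) *m (b j)^H).
  rewrite mxE mulmx_suml linear_sum; apply: eq_bigr => i _.
  by rewrite mxE -scalemxAl linearZ.
have Gfree : row_free G.
  apply: inj_row_free => v v0; apply: vbasis_sum_eq0; apply: mxtrace_adj_eq0.
  by apply: tr0 => [j|]; [rewrite -sumG v0 mxE | exact: vsum_vbasis].
have/row_freeP [H GH] := Gfree.
have HG : H *m G = 1%:M by exact: mulmx1C.
pose a := (\row_j \tr (M *m (b j)^H)) *m H.
exists (\sum_i a 0 i *: b i); first exact: vsum_vbasis.
apply: tr0 => j.
by rewrite mulmxBl linearB /= -sumG -mulmxA HG mulmx1 mxE subrr.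
Qed.

Section SelfAdjointAlgebra.
Variables (n : nat) (V : {vspace 'M[C]_n}).
Hypotheses (VM : mul_closed V) (V1 : 1%:M \in V).
Hypothesis Vadj : {in V, forall A, A^H \in V}.

(* [f] is the orthogonal projection of [1] on [K]: an element [(1 - f) k] of [K] is *)
(* orthogonal to [K], hence zero.                                                 *)
Lemma ideal_unit (K : {vspace 'M[C]_n}) :
    (K <= V)%VS -> {in V & K, forall a k, a *m k \in K} ->
    {in V & K, forall a k, k *m a \in K} ->
  exists f, [/\ central_idempotent V f, f \in K & {in K, forall k, f *m k = k}].
Proof.
move=> /subvP KV Kl Kr; have [f fK fP] := orthogonal_projection K 1%:M.
have fl : {in K, forall k, f *m k = k}.
  move=> k kK; suff /eqP : (1%:M - f) *m k = 0.
    by rewrite mulmxBl mul1mx subr_eq0 => /eqP.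
  set q := _ *m k; have qK : q \in K.
    by rewrite /q mulmxBl mul1mx; apply: rpredB => //; apply: Kl => //; apply: KV.
  apply: mxtrace_adj_eq0; rewrite {1}/q -mulmxA.
  have -> : k *m q^H = (q *m k^H)^H by rewrite (mulmx_adj q) adjK.
  by apply: fP; apply: Kr => //; exact: Vadj (KV _ _).
have fr : {in K, forall k, k *m f = k}.
  move=> k kK; suff /eqP : k *m (1%:M - f) = 0.
    by rewrite mulmxBr mulmx1 subr_eq0 => /eqP.
  set q := k *m _; have qK : q \in K.
    by rewrite /q mulmxBr mulmx1; apply: rpredB => //; apply: Kl => //; apply: KV.
  apply: mxtrace_adj_eq0; rewrite {1}/q -mulmxA mxtrace_mulC -mulmxA.
  have -> : q^H *m k = (k^H *m q)^H by rewrite (mulmx_adj _ q) adjK.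
  by apply: fP; apply: Kl => //; exact: Vadj (KV _ _).
exists f; split=> //; split; [exact: KV | move=> a aV | exact: fl].
by rewrite -[RHS]fl ?Kl // mulmxA fr // Kr.
Qed.

(** A representation is a total function constrained only on [V]; a linear map with the same values
    on a basis of [V] gives access to kernels and sums. *)
Lemma repr_linfun k (rho : 'M[C]_n -> 'M[C]_k) :
  irr_repr V rho ->
  exists2 f : 'Hom('M[C]_n, 'M[C]_k), irr_repr V f & {in V, f =1 rho}.
Proof.
case=> -[rhoL rhoM rho1] k_gt0 irr.
have [g gP] := linear_of_free (vbasis V) (map rho (vbasis V)).
have {}gP := gP (basis_free (vbasisP V)) (size_map _ _).
have eqf : {in V, linfun g =1 rho}.
  have rho0 : rho 0 = 0.
    have := rhoL 1 0 0 (mem0v _) (mem0v _).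
    by rewrite !scale1r addr0 => /eqP; rewrite -subr_eq0 opprD addrA subrr add0r oppr_eq0 => /eqP.
  move=> A /coord_vbasis ->; rewrite lfunE linear_sum /=.
  suff [] : \sum_i g (coord (vbasis V) i A *: (vbasis V)`_i)
      = rho (\sum_i coord (vbasis V) i A *: (vbasis V)`_i)
      /\ \sum_i coord (vbasis V) i A *: (vbasis V)`_i \in V by [].
  apply: (big_rec2 (fun x y => x = rho y /\ y \in V)) => [|i x y _ [-> yV]].
    by rewrite rho0 mem0v.
  have iV := vbasis_nth_mem i; split; last by rewrite memvD ?memvZ.
  rewrite rhoL // linearZ /=; congr (_ *: _ + _).
  by rewrite -(nth_map 0 0) ?size_tuple // gP (nth_map 0) ?size_tuple.
exists (linfun g) => //; split=> //; first split.
- by move=> a A B _ _; rewrite linearP.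
- by move=> A B AV BV; rewrite !eqf // ?rhoM // VM.
- by rewrite eqf.
- by move=> U UP; apply: irr => A AV; rewrite -eqf // UP.
Qed.

(** Centrality makes the row space of [rho f] a submodule, so irreducibility leaves zero or an
    invertible idempotent. *)
Lemma irr_central_idempotent k (rho : 'M[C]_n -> 'M[C]_k) f :
  irr_repr V rho -> central_idempotent V f -> rho f = 0 \/ rho f = 1%:M.
Proof.
case=> -[_ rhoM rho1] _ irr [fV fC ff].
have [A AV||/row_fullP [B hB]] := irr (rho f); [|by left|right].
  by rewrite -rhoM // fC // rhoM // submxMl.
by rewrite -[LHS]mul1mx -hB -mulmxA -rhoM // ff.
Qed.

(** The rows [v *m f u], for [u] in the right ideal [U], form a submodule; if nonzero, it is
    everything. *)
Lemma irr_orbit_full (U : {vspace 'M[C]_n}) k (f : 'Hom('M[C]_n, 'M[C]_k)) (v : 'rV_k) :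
    (U <= V)%VS -> {in U & V, forall u a, u *m a \in U} -> irr_repr V f ->
    (exists2 u, u \in U & v *m f u != 0) ->
  row_full (\matrix_(i < \dim U) (v *m f (vbasis U)`_i)).
Proof.
move=> /subvP UV Ur [[_ fM _] _ irr] [u uU vu0]; set P := \matrix_i _.
have inP x : x \in U -> (v *m f x <= P)%MS.
  move=> /coord_vbasis ->; rewrite linear_sum mulmx_sumr; apply: summx_sub => i _.
  rewrite linearZ -scalemxAr scalemx_sub //.
  have <- : row i P = v *m f (vbasis U)`_i by rewrite rowK.
  exact: row_sub.
(* Irreducibility tests square matrices, and [<<P>>] is a square matrix with the row space of
   [P]. *)
have [A AV|P0|] := irr <<P>>%MS; last by rewrite -!sub1mx genmxE.
  rewrite genmxE (eqmxMr _ (genmxE _)); apply/row_subP => i.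
  have iU := vbasis_nth_mem i.
  by rewrite row_mul rowK -mulmxA -fM ?(UV _ iU) //; apply: inP; apply: Ur.
have P00 : P = 0 by apply/eqP; rewrite -mxrank_eq0 -mxrank_gen P0 mxrank0.
by case/submxP: (inP u uU) vu0 => B ->; rewrite P00 mulmx0 eqxx.
Qed.

Lemma vbasis_comb_orbit (U : {vspace 'M[C]_n}) k (f : 'Hom('M[C]_n, 'M[C]_k)) (v : 'rV_k) w :
  w *m (\matrix_(i < \dim U) (v *m f (vbasis U)`_i))
  = v *m f (\sum_i w 0 i *: (vbasis U)`_i).
Proof.
rewrite mulmx_sum_row linear_sum mulmx_sumr; apply: eq_bigr => i _.
by rewrite rowK linearZ -scalemxAr.
Qed.

(** * Right ideals below a central primitive idempotent *)

Section PrimitiveIdempotent.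
Variable E : 'M[C]_n.
Hypothesis E_prim : central_primitive_idempotent V E.

(** [E *m E^H] is a central idempotent below [E], nonzero because its trace is the squared norm of
    [E]; primitivity makes it equal to [E]. *)
Lemma primitive_self_adjoint : E^H = E.
Proof.
have [[EV EC EE] E0 Eprim] := E_prim; have EaV := Vadj EV.
have EaC : {in V, forall A, E^H *m A = A *m E^H}.
  by move=> A AV; rewrite -[A]adjK -!mulmx_adj EC ?Vadj.
have EEa : central_idempotent V (E *m E^H).
  split; first exact: VM.
  - by move=> A AV; rewrite -mulmxA EaC // !mulmxA EC.
  - by rewrite -mulmxA (mulmxA E^H) EaC // -!mulmxA -mulmx_adj EE mulmxA EE.
have [|EEa0|EEaE] := Eprim _ EEa; first by rewrite mulmxA EE.
  by case/eqP: E0; apply: mxtrace_adj_eq0; rewrite EEa0 mxtrace0.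
by rewrite -EEaE mulmx_adj adjK.
Qed.

(** The kernel of [f] in [V] is an ideal with a central unit [g], and [E *m g] is 0 or [E]. The
    latter would give [f E = 0]; the former kills every [a = E a] in the kernel. *)
Lemma irr_faithful k (f : 'Hom('M[C]_n, 'M[C]_k)) a :
  irr_repr V f -> f E != 0 -> a \in V -> E *m a = a -> f a = 0 -> a = 0.
Proof.
move=> irr fE0 aV Ea fa0.
have [[EV EC EE] E0 Eprim] := E_prim; have [[_ fM _] _ _] := irr.
have [|||g [gc gK gl]] := @ideal_unit (V :&: lker f)%VS.
- exact: capvSl.
- move=> x y xV; rewrite !memv_cap !memv_ker => /andP [yV /eqP fy].
  by rewrite VM //= fM // fy mulmx0.
- move=> x y xV; rewrite !memv_cap !memv_ker => /andP [yV /eqP fy].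
  by rewrite VM //= fM // fy mul0mx.
move: gK; rewrite memv_cap memv_ker => /andP [gV /eqP fg].
have [gV' gC gg] := gc.
have Egc : central_idempotent V (E *m g).
  split; first exact: VM.
  - by move=> x xV; rewrite -mulmxA gC // mulmxA EC // mulmxA.
  - by rewrite -mulmxA (mulmxA g) gC // -!mulmxA gg mulmxA EE.
have [|Eg|Eg] := Eprim _ Egc; first by rewrite mulmxA EE.
- by rewrite -Ea -(gl a) ?mulmxA ?Eg ?mul0mx // memv_cap aV memv_ker fa0 /=.
- by move: fE0; rewrite -Eg fM // fg mulmx0 eqxx.
Qed.

(** The last clause places [U] inside [E V], which is written below as the image of [V] under
    [linfun (mulmx E)]. *)
Definition right_ideal_at (U : {vspace 'M[C]_n}) :=
  [/\ (U <= V)%VS, {in U & V, forall u a, u *m a \in U} & {in U, forall u, E *m u = u}].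

Lemma right_ideal_at_limg : right_ideal_at (linfun (mulmx E) @: V)%VS.
Proof.
have [[EV EC EE] E0 Eprim] := E_prim; split.
- by apply/subvP => u /memv_imgP [a aV ->]; rewrite lfunE /= VM.
- move=> u b /memv_imgP [a aV ->] bV; rewrite lfunE /= -mulmxA.
  by rewrite -[_ *m (_ *m _)](lfunE (mulmx E)) memv_img // VM.
- by move=> u /memv_imgP [a aV ->]; rewrite lfunE /= mulmxA EE.
Qed.

Lemma idem_in_limg : E \in (linfun (mulmx E) @: V)%VS.
Proof. by rewrite -[X in X \in _]mulmx1 -(lfunE (mulmx E)) memv_img. Qed.

Lemma minimal_right_ideal :
  exists U, [/\ right_ideal_at U, U != 0%VS
    & forall U', right_ideal_at U' -> (U' <= U)%VS -> U' = 0%VS \/ U' = U].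
Proof.
have [_ E0 _] := E_prim.
pose P d := `[< exists U, [/\ right_ideal_at U, U != 0%VS & \dim U = d] >].
have exP : exists d, P d.
  exists (\dim (linfun (mulmx E) @: V)); apply/asboolP; exists (linfun (mulmx E) @: V)%VS.
  split=> //; first exact: right_ideal_at_limg.
  by apply: contraNneq E0 => EV0; move: idem_in_limg; rewrite EV0 memv0.
case: (ex_minnP exP) => d /asboolP [U [Uid U0 dU]] dmin.
exists U; split=> // U' Uid' sU; have [->|U'0] := eqVneq U' 0%VS; [by left|right].
apply/eqP; rewrite eqEdim sU dU dmin //; apply/asboolP; exists U'; by split.
Qed.

(* Both representations are isomorphic to a minimal right ideal of [E V].         *)
Lemma irr_trace_unique k k' (f : 'M[C]_n -> 'M[C]_k) (f' : 'M[C]_n -> 'M[C]_k') :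
    irr_repr V f -> irr_repr V f' -> f E != 0 -> f' E != 0 ->
  {in V, forall A, \tr (f A) = \tr (f' A)}.
Proof.
have [[EV _ _] _ _] := E_prim.
have [U [Uid U0 Umin]] := minimal_right_ideal; have [UV Ur EU] := Uid.
(* The right-hand side is the trace of right multiplication by [A] on [U], which does not involve
   [g]. *)
suff trU m (g : 'M[C]_n -> 'M[C]_m) : irr_repr V g -> g E != 0 -> {in V, forall A,
    \tr (g A) = \sum_i coord (vbasis U) i ((vbasis U)`_i *m A)}.
  by move=> irr irr' fE f'E A AV; rewrite !trU.
case/repr_linfun => h irr hg; rewrite -hg // => hE A AV; rewrite -hg //.
have [[_ hM _] _ _] := irr.
have [u uU hu] : exists2 u, u \in U & h u != 0.
  have u0 : vpick U != 0 by rewrite vpick0.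
  exists (vpick U); first exact: memv_pick.
  apply: contraNneq u0 => h0; apply/eqP; apply: (irr_faithful irr hE) => //.
    by apply: (subvP UV); exact: memv_pick.
  by apply: EU; exact: memv_pick.
have [r hr] : exists r, row r (h u) != 0.
  apply/existsP; apply: contraNT hu; rewrite negb_exists => /forallP all0.
  by apply/eqP/row_matrixP => r; rewrite row0; apply/eqP; rewrite -[_ == _]negbK.
pose v := delta_mx 0 r : 'rV[C]_m.
have vu : exists2 u, u \in U & v *m h u != 0 by exists u => //; rewrite -rowE.
pose P := \matrix_(i < \dim U) (v *m h (vbasis U)`_i).
have /row_fullP [Q QP] : row_full P by exact: irr_orbit_full.
have Pfree : row_free P.
  apply: inj_row_free => w; rewrite vbasis_comb_orbit => w0.
  apply: vbasis_sum_eq0.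
  (* The kernel of a |-> v h(a) in [U] is a right ideal, and not all of [U] since [v *m h u] is
     nonzero; by minimality the map is injective. *)
  have [|K0|KU] := Umin (U :&: lker (linfun (mulmx v) \o h))%VS _ (capvSl _ _).
  - split.
    + exact: subv_trans (capvSl _ _) UV.
    + move=> x a; rewrite !memv_cap !memv_ker !comp_lfunE !lfunE /= => /andP [xU /eqP vx] aV.
      by rewrite Ur // hM ?(subvP UV _ xU) // mulmxA vx mul0mx /=.
    + by move=> x; rewrite memv_cap => /andP [xU _]; exact: EU.
  - apply/eqP; rewrite -memv0 -K0 memv_cap vsum_vbasis memv_ker comp_lfunE lfunE /=.
    by rewrite w0.
  - have/subvP sub : (U <= U :&: lker (linfun (mulmx v) \o h))%VS by rewrite KU.
    case: vu => x /sub; rewrite memv_cap memv_ker comp_lfunE lfunE /=.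
    case/andP=> _ /eqP ->.
    by rewrite eqxx.
have PQ : P *m Q = 1%:M.
  have/row_freeP [Q' PQ'] := Pfree.
  by rewrite -[Q]mulmx1 -PQ' !mulmxA -(mulmxA P Q P) QP mulmx1.
(* [M] is right multiplication by [A] in the basis of [U]; the invertible [P] conjugates it to
   [h A]. *)
pose M := \matrix_(i < \dim U, j < \dim U) coord (vbasis U) j ((vbasis U)`_i *m A).
have PM : P *m h A = M *m P.
  apply/row_matrixP => i; rewrite !row_mul vbasis_comb_orbit rowK -mulmxA -hM //; last first.
    by apply: (subvP UV); exact: vbasis_nth_mem.
  have iA : (vbasis U)`_i *m A \in U by apply: Ur => //; exact: vbasis_nth_mem.
  by rewrite {1}(coord_vbasis iA); congr (v *m h _); apply: eq_bigr => j _; rewrite !mxE.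
rewrite -[h A]mul1mx -QP -mulmxA PM mxtrace_mulC -mulmxA PQ mulmx1.
by apply: eq_bigr => i _; rewrite mxE.
Qed.

(** By [irr_trace_unique], a constituent whose representation does not kill [E] has character [phi]
    on [V]; multiplicity one leaves a single such constituent. *)
Lemma char_at_idempotent (chi phi : 'M[C]_n -> C) :
    irr_char V phi -> phi E = phi 1%:M -> char_multiplicity V chi phi 1 ->
  chi E = phi 1%:M.
Proof.
have [Ec _ _] := E_prim; have [EV _ _] := Ec.
case=> k [rho [irr phiE]] phiE1 [r [psi [irrpsi chiE cnt]]].
have rhoE : rho E != 0.
  apply: contraTneq isT => rho0; have [[_ _ rho1] k_gt0 _] := irr.
  move: phiE1; rewrite !phiE // rho0 rho1 mxtrace0 mxtrace1 => /esym/eqP.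
  by rewrite pnatr_eq0 => /eqP k0; move: k_gt0; rewrite k0.
have psiE i : i \notin [set i | `[< {in V, psi i =1 phi} >]] -> psi i E = 0.
  rewrite inE => /asboolP neq; have [k' [rho' [irr' psiE]]] := irrpsi i.
  have [E0|E0] := eqVneq (rho' E) 0; first by rewrite psiE // E0 mxtrace0.
  by case: neq => A AV; rewrite psiE // phiE //; apply: irr_trace_unique.
move/eqP/cards1P: cnt => [i0 i0P]; rewrite chiE // (bigD1 i0) //= big1 => [|i ii0].
  rewrite addr0; have : i0 \in [set i | `[< {in V, psi i =1 phi} >]] by rewrite i0P inE.
  by rewrite inE => /asboolP ->.
by apply: psiE; rewrite i0P inE.
Qed.

(* The maps [a |-> v rho(a)] on [E V] are onto, hence injective for [v != 0]; so   *)
(* [a - z E = 0] when [v] is an eigenvector of [rho(a)] for [z].                   *)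
Lemma irr_degree1 k (rho : 'M[C]_n -> 'M[C]_k) :
    irr_repr V rho -> rho E != 0 -> (\dim (linfun (mulmx E) @: V) <= k)%N -> k = 1%N.
Proof.
have [Ec _ _] := E_prim; have [EV EC EE] := Ec.
case/repr_linfun => h irr hr; rewrite -hr // => hE dimk; have [_ k_gt0 _] := irr.
have h1 : h E = 1%:M by case: (irr_central_idempotent irr Ec) hE => // ->; rewrite eqxx.
have [UV Ur EU] := right_ideal_at_limg; set U := (_ @: V)%VS in dimk UV Ur EU.
have full (v : 'rV_k) : v != 0 -> row_full (\matrix_(i < \dim U) (v *m h (vbasis U)`_i)).
  move=> v0; apply: irr_orbit_full => //; exists E; first exact: idem_in_limg.
  by rewrite h1 mulmx1.
have dimU : \dim U = k.
  apply/eqP; rewrite eqn_leq dimk /=.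
  (* Any nonzero row serves: its orbit matrix has rank [k] and [\dim U] rows. *)
  have v0 : const_mx 1 != 0 :> 'rV[C]_k.
    apply/eqP => /rowP /(_ (Ordinal k_gt0)); rewrite !mxE => /eqP.
    by rewrite oner_eq0.
  by have /eqP <- := full _ v0; rewrite rank_leq_row.
suff : (U <= <[E]>)%VS.
  by move/dimvS; rewrite dim_vline dimU; case: (k) k_gt0 => [|[|?]] //; case: (_ == _).
apply/subvP => a aU.
have [z /eigenvalueP [v va v0]] : exists z, eigenvalue (h a) z.
  have /closed_rootP [z] : size (char_poly (h a)) != 1%N.
    by rewrite size_char_poly eqSS -lt0n.
  by rewrite -eigenvalue_root_char; exists z.
suff /eqP : a - z *: E = 0 by rewrite subr_eq0 => /eqP ->; rewrite memvZ ?memv_line.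
have bU : a - z *: E \in U by rewrite memvB ?memvZ // idem_in_limg.
(* As [\dim U = k], the orbit matrix is square, so its full rank also makes a |-> v h(a) injective
   on [U]. *)
have free : row_free (\matrix_(i < \dim U) (v *m h (vbasis U)`_i)).
  by rewrite /row_free (eqP (full v v0)) dimU.
rewrite (coord_vbasis bU).
suff w0 : \row_i coord (vbasis U) i (a - z *: E) = 0.
  by apply: big1 => i _; have /rowP /(_ i) := w0; rewrite !mxE => ->; rewrite scale0r.
apply: (row_free_inj free); rewrite mul0mx vbasis_comb_orbit.
under eq_bigr do rewrite mxE.
by rewrite -coord_vbasis // linearB linearZ /= h1 mulmxBr va -scalemxAr mulmx1 subrr.
Qed.

End PrimitiveIdempotent.
End SelfAdjointAlgebra.
End HermitianForm.

(** * Homogeneous coherent configurations *)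

Section Entries.
Variables (F : fieldType) (X : finType).
Implicit Types (A B : 'MX[F]_X) (c : {set X * X}) (P : {set {set X * X}}).

Lemma entryP A B : (forall x y, entry A x y = entry B x y) -> A = B.
Proof.
move=> eqAB; apply/matrixP => i j; move: (eqAB (enum_val i) (enum_val j)).
by rewrite /entry !enum_valK.
Qed.

Lemma entry_adjmx c x y : entry (adjmx F c) x y = ((x, y) \in c)%:R.
Proof. by rewrite /entry mxE !enum_rankK. Qed.

Lemma entry_mulmx A B x y : entry (A *m B) x y = \sum_z entry A x z * entry B z y.
Proof.
rewrite /entry mxE (reindex enum_rank) //.
by exists enum_val => i _; rewrite (enum_rankK, enum_valK).
Qed.

Lemma entry1 x y : entry (1%:M : 'MX[F]_X) x y = (x == y)%:R.
Proof. by rewrite /entry mxE (inj_eq enum_rank_inj). Qed.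

Lemma adjmx_diagonal : adjmx F (@Defs.diagonal X) = 1%:M.
Proof. by apply: entryP => x y; rewrite entry_adjmx entry1 inE. Qed.

Lemma entry_sum (I : finType) (Q : pred I) (G : I -> 'MX[F]_X) x y :
  entry (\sum_(i | Q i) G i) x y = \sum_(i | Q i) entry (G i) x y.
Proof. by rewrite /entry summxE. Qed.

Lemma entryZ a A x y : entry (a *: A) x y = a * entry A x y.
Proof. by rewrite /entry mxE. Qed.

Lemma span_enumP (vT : vectType F) (T : finType) (Q : {set T}) (g : T -> vT) v :
  v \in <<[seq g t | t <- enum Q]>>%VS -> exists a, v = \sum_(t in Q) a t *: g t.
Proof.
move=> vQ; suff [a ->] : exists a, v = \sum_(t <- enum Q) a t *: g t.
  by exists a; rewrite big_enum.
elim: (enum Q) (enum_uniq Q) v vQ => [_ v|t s IHs /= /andP [ts us] v].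
  by rewrite span_nil memv0 => /eqP ->; exists (fun=> 0); rewrite big_nil.
rewrite span_cons => /memv_addP [_ /vlineP [b ->] [w /(IHs us) [a ->] ->]].
exists (fun r => if r == t then b else a r); rewrite big_cons eqxx; congr (_ + _).
by apply: eq_big_seq => r rs; case: eqP ts => // <-; rewrite rs.
Qed.

(** Disjointness lets the coefficient of a member be read at any of its pairs, so membership in a
    span becomes a condition on entries. *)
Lemma adj_spanP P A : trivIset P ->
  reflect ((forall x y, (x, y) \notin cover P -> entry A x y = 0) /\
    {in P, forall c x y x' y', (x, y) \in c -> (x', y') \in c -> entry A x y = entry A x' y'})
  (A \in adj_span F P).
Proof.
move=> tP.
have ent (a : {set X * X} -> F) x y c : c \in P -> (x, y) \in c ->
    entry (\sum_(c in P) a c *: adjmx F c) x y = a c.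
  move=> cP xyc; rewrite entry_sum (bigD1 c) //= entryZ entry_adjmx xyc mulr1 big1 ?addr0 //.
  move=> d /andP [dP dc]; rewrite entryZ entry_adjmx.
  case: (boolP (_ \in d)) => [xyd|]; last by rewrite mulr0.
  by rewrite -(def_pblock tP dP xyd) (def_pblock tP cP xyc) eqxx in dc.
have ent0 (a : {set X * X} -> F) x y : (x, y) \notin cover P ->
    entry (\sum_(c in P) a c *: adjmx F c) x y = 0.
  move=> nxy; rewrite entry_sum big1 // => c cP; rewrite entryZ entry_adjmx.
  case: (boolP (_ \in c)) => [xyc|]; last by rewrite mulr0.
  by case/bigcupP: nxy; exists c.
apply: (iffP idP) => [/span_enumP [a ->]|[A0 Ac]].
  by split=> [x y /ent0 -> // | c cP x y x' y' xyc xyc']; rewrite !(ent a _ _ c).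
(* The default 0 is reached only for empty [c], whose adjacency matrix vanishes. *)
have -> : A = \sum_(c in P)
    (if [pick p in c] is Some p then entry A p.1 p.2 else 0) *: adjmx F c.
  apply: entryP => x y; case: (boolP ((x, y) \in cover P)) => [/bigcupP [c cP xyc]|nxy].
    rewrite (ent _ _ _ c) //; case: pickP => [[x' y'] /= xyc'|/(_ (x, y))].
      exact: (Ac c).
    by rewrite xyc.
  by rewrite ent0 // A0.
apply: rpred_sum => c cP; apply: rpredZ; apply: memv_span.
by apply: map_f; rewrite mem_enum.
Qed.

Lemma adjmx_in_span P c : c \in P -> adjmx F c \in adj_span F P.
Proof. by move=> cP; apply: memv_span; apply: map_f; rewrite mem_enum. Qed.

Lemma adj_spanS P (Q : {set {set X * X}}) : P \subset Q -> (adj_span F P <= adj_span F Q)%VS.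
Proof.
move=> /subsetP sPQ; apply: sub_span => A /mapP [c]; rewrite mem_enum => cP ->.
by apply: map_f; rewrite mem_enum sPQ.
Qed.

Lemma adjmx_cover_in_span P : trivIset P -> adjmx F (cover P) \in adj_span F P.
Proof.
move=> tP; apply/adj_spanP => //; split=> [x y /negPf nxy|c cP x y x' y' xyc xyc'].
  by rewrite entry_adjmx nxy.
by rewrite !entry_adjmx !(subsetP (bigcup_sup c cP)).
Qed.

Lemma span_mul_closed n (s : seq 'M[F]_n) :
  {in s &, forall M N, M *m N \in <<s>>%VS} -> mul_closed <<s>>%VS.
Proof.
move=> hs M N Ms Ns; rewrite (coord_span (X := in_tuple s) Ms) (coord_span (X := in_tuple s) Ns).
rewrite mulmx_suml.
have ns i : (i < size s)%N -> s`_i \in s by exact: mem_nth.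
apply: rpred_sum => i _; rewrite mulmx_sumr; apply: rpred_sum => j _.
by rewrite -scalemxAl -scalemxAr; do 2!apply: rpredZ; apply: hs; apply: ns.
Qed.

End Entries.

Section Positivity.
Variables (F : numClosedFieldType) (X : finType).
Implicit Types (A B : 'MX[F]_X) (c : {set X * X}) (P : {set {set X * X}}).

Definition nonneg_mx A := forall x y, 0 <= entry A x y.

Lemma nonneg_adjmx c : nonneg_mx (adjmx F c).
Proof. by move=> x y; rewrite entry_adjmx ler0n. Qed.

Lemma nonneg_mulmx A B : nonneg_mx A -> nonneg_mx B -> nonneg_mx (A *m B).
Proof. by move=> hA hB x y; rewrite entry_mulmx; apply: sumr_ge0 => z _; rewrite mulr_ge0. Qed.

(** Nonnegative terms cannot cancel, so products of adjacency matrices detect composition of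
    relations. *)
Lemma entry_mulmx_neq0 A B x y : nonneg_mx A -> nonneg_mx B ->
  reflect (exists z, entry A x z != 0 /\ entry B z y != 0) (entry (A *m B) x y != 0).
Proof.
move=> hA hB; rewrite entry_mulmx psumr_eq0 => [|z _]; last by rewrite mulr_ge0.
apply: (iffP allPn) => [[z _]|[z [Az Bz]]]; last by exists z; rewrite ?mem_index_enum //= mulf_neq0.
by rewrite mulf_eq0 negb_or => /andP [Az Bz]; exists z.
Qed.

Lemma entry_adjmx_neq0 c x y : (entry (adjmx F c) x y != 0) = ((x, y) \in c).
Proof. by rewrite entry_adjmx pnatr_eq0 eqb0 negbK. Qed.

Lemma entry_adj A x y : entry A^H x y = (entry A y x)^*.
Proof. by rewrite /entry !mxE. Qed.

Lemma adjmx_transp c : adjmx F (transp c) = (adjmx F c)^H.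
Proof. by apply: entryP => x y; rewrite entry_adj !entry_adjmx inE conjC_nat. Qed.

Lemma adj_span_adj P : {in P, forall c, transp c \in P} ->
  {in adj_span F P, forall A, A^H \in adj_span F P}.
Proof.
move=> tP A /span_enumP [a ->]; rewrite linear_sum map_mx_sum /=.
apply: rpred_sum => c cP; rewrite linearZ /= map_mxZ -adjmx_transp.
by apply: rpredZ; apply: adjmx_in_span; apply: tP.
Qed.

End Positivity.

Section ClosedSubset.
Variables (F : numClosedFieldType) (X : finType) (C D : {set {set X * X}}).
Hypotheses (hC : homogeneous_cc F C) (hD : closed_subset F C D).
Implicit Types c d : {set X * X}.

Lemma cc_trivIset : trivIset C.
Proof. by case: hC => /and3P []. Qed.

Lemma cc_class p : exists2 c, c \in C & p \in c.
Proof.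
case: hC => /and3P [/eqP cov _ _] _ _ _.
by have /bigcupP [c cC pc] : p \in cover C by [rewrite cov inE]; exists c.
Qed.

Lemma cc_nonempty c : c \in C -> exists x y, (x, y) \in c.
Proof.
case: hC => /and3P [_ _ C0] _ _ _ cC; have [c0|[[x y] xyc]] := set_0Vmem c.
  by rewrite c0 (negPf C0) in cC.
by exists x, y.
Qed.

Lemma cc_uniq c d p : c \in C -> d \in C -> p \in c -> p \in d -> c = d.
Proof.
by move=> cC dC pc pd; rewrite -(def_pblock cc_trivIset cC pc) (def_pblock cc_trivIset dC pd).
Qed.

Lemma cc_const A c x y x' y' : A \in adj_span F C -> c \in C ->
  (x, y) \in c -> (x', y') \in c -> entry A x y = entry A x' y'.
Proof. by move=> /(adj_spanP _ cc_trivIset) [_ Ac] cC; apply: Ac. Qed.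

Lemma cc_adj A : A \in adj_span F C -> A^H \in adj_span F C.
Proof. by apply: adj_span_adj; case: hC. Qed.

Lemma cc_mul : mul_closed (adj_span F C).
Proof. by case: hC. Qed.

Lemma cc_diag_const A x y : A \in adj_span F C -> entry A x x = entry A y y.
Proof.
case: hC => _ _ dC _ AC.
by apply: (cc_const AC dC); rewrite inE.
Qed.

(** The (x, x)-entry of [A *m A^H] counts the [c]-neighbours of [x], and it is the same for all [x]
    because the product lies in the adjacency algebra. *)
Lemma cc_out c x : c \in C -> exists y, (x, y) \in c.
Proof.
move=> cC; have [u [v uvc]] := cc_nonempty cC; set A := adjmx F c.
have AC : A *m A^H \in adj_span F C.
  by apply: cc_mul; [|apply: cc_adj]; exact: adjmx_in_span.
have A0 : nonneg_mx A^H by rewrite -adjmx_transp; exact: nonneg_adjmx.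
have : entry (A *m A^H) x x != 0.
  rewrite (cc_diag_const x u AC); apply/entry_mulmx_neq0 => //; first exact: nonneg_adjmx.
  by exists v; rewrite -adjmx_transp !entry_adjmx_neq0 inE.
case/entry_mulmx_neq0 => // [|y []]; first exact: nonneg_adjmx.
by rewrite entry_adjmx_neq0; exists y.
Qed.

Let J := adjmx F (cover D).

Lemma closed_trivIset : trivIset D.
Proof. by case: hD => _ DC _; apply: trivIsetS DC cc_trivIset. Qed.

Lemma closed_span : (adj_span F D <= adj_span F C)%VS.
Proof. by case: hD => _ DC _; exact: adj_spanS. Qed.

Lemma closed_J : J \in adj_span F D.
Proof. exact: adjmx_cover_in_span closed_trivIset. Qed.

Lemma closed_J_cc : J \in adj_span F C.
Proof. exact: subvP closed_span _ closed_J. Qed.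

Lemma in_block x y : (y \in block_of D x) = ((x, y) \in cover D).
Proof.
rewrite inE; apply/existsP/bigcupP => [[d /andP [dD xyd]]|[d dD xyd]]; first by exists d.
by exists d; rewrite dD.
Qed.

(** [J *m J] lies in the span of [D], hence vanishes off [cover D], while its (x, z)-entry counts
    the intermediate points. *)
Lemma block_trans x y z :
  y \in block_of D x -> z \in block_of D y -> z \in block_of D x.
Proof.
rewrite !in_block => xy yz; apply: contraTT isT => /= xz.
have JJ : J *m J \in adj_span F D by case: hD => _ _; apply; exact: closed_J.
have /eqP : entry (J *m J) x z = 0.
  by have /(adj_spanP _ closed_trivIset) [-> //] := JJ.
suff /negPf -> : entry (J *m J) x z != 0 by [].
apply/entry_mulmx_neq0; [exact: nonneg_adjmx.. | exists y].
by rewrite !entry_adjmx_neq0.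
Qed.

Lemma card_block x y : #|block_of D x| = #|block_of D y|.
Proof.
apply/eqP; rewrite -(eqr_nat F); apply/eqP.
suff JE z : #|block_of D z|%:R = entry (J *m J^H) z z.
  by rewrite !JE; apply: cc_diag_const; apply: cc_mul; [|apply: cc_adj]; exact: closed_J_cc.
rewrite entry_mulmx -sum1_card natr_sum big_mkcond /=; apply: eq_bigr => w _.
rewrite entry_adj entry_adjmx conjC_nat -natrM mulnb andbb in_block.
by case: (_ \in _).
Qed.

Lemma block_gt0 x : (0 < #|block_of D x|)%N.
Proof.
case: hD => /set0Pn [d dD] /subsetP DC _.
have [y [z yzd]] := cc_nonempty (DC _ dD); rewrite (card_block x y).
by apply/card_gt0P; exists z; rewrite in_block; apply/bigcupP; exists d.
Qed.

(* Transitivity gives [yD] included in [xD], and the two sets have the same size. *)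
Lemma block_eq x y : y \in block_of D x -> block_of D y = block_of D x.
Proof.
move=> xy; apply/eqP; rewrite eqEcard (card_block x y) leqnn andbT.
by apply/subsetP => z; exact: block_trans.
Qed.

(** Any [y] in the block of [x] has the same block, hence lies in its own; the member of [D] through
    (y, y) can then only be the diagonal. *)
Lemma block_refl x : x \in block_of D x.
Proof.
have [y xy] := card_gt0P (block_gt0 x).
have yy : y \in block_of D y by rewrite (block_eq xy).
have diagC : (@Defs.diagonal X) \in C by case: hC.
suff dD : (@Defs.diagonal X) \in D.
  by rewrite in_block; apply/bigcupP; exists (@Defs.diagonal X) => //; rewrite inE.
move: yy; rewrite in_block => /bigcupP [d dD yyd].
have dC : d \in C by case: hD => _ /subsetP DC _; exact: DC.
by rewrite (@cc_uniq (@Defs.diagonal X) d (y, y)) // inE.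
Qed.

Lemma block_eqE x y : (y \in block_of D x) = (block_of D x == block_of D y).
Proof.
by apply/idP/eqP => [/block_eq -> //|->]; exact: block_refl.
Qed.

Lemma closed_transp d : d \in D -> transp d \in D.
Proof.
case: hD => _ /subsetP DC _ dD; have [x [y xyd]] := cc_nonempty (DC _ dD).
have : x \in block_of D y.
  by rewrite block_eqE eq_sym -block_eqE in_block; apply/bigcupP; exists d.
rewrite in_block => /bigcupP [d' d'D yxd'].
rewrite (@cc_uniq (transp d) d' (y, x)) ?(DC d') ?inE //.
by case: hC => _ tC _ _; apply: tC; exact: DC.
Qed.

Lemma closed_adj : {in adj_span F D, forall A, A^H \in adj_span F D}.
Proof. exact: adj_span_adj closed_transp. Qed.

Lemma closed_one : 1%:M \in adj_span F D.
Proof.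
apply/(adj_spanP _ closed_trivIset); split=> [x y|d dD x y x' y' xyd xyd'].
  rewrite entry1; case: eqP => // ->; rewrite -in_block block_refl //.
have diagC : (@Defs.diagonal X) \in C by case: hC.
have one : 1%:M \in adj_span F C by rewrite -adjmx_diagonal adjmx_in_span.
by apply: (cc_const one) xyd xyd'; case: hD => _ /subsetP ->.
Qed.

(** By [cc_out] every member of [C] meets the row of [x], so this row shows all the coefficients of
    [A]. *)
Lemma closed_row_eq0 A x : A \in adj_span F D ->
  (forall y, y \in block_of D x -> entry A x y = 0) -> A = 0.
Proof.
move=> AD A0; apply: entryP => u v; rewrite [RHS]mxE.
have [Aout _] := adj_spanP _ closed_trivIset AD.
case: (boolP ((u, v) \in cover D)) => [/bigcupP [d dD uvd]|/Aout -> //].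
have dC : d \in C by case: hD => _ /subsetP DC _; exact: DC.
have [y xyd] := cc_out x dC.
rewrite -(A0 y) ?in_block; last by apply/bigcupP; exists d.
exact: (cc_const (subvP closed_span _ AD) dC).
Qed.

(** * The factor configuration *)

Definition block_pt x : factor_pts D :=
  exist (fun B => B \in blocks D) (block_of D x) (imset_f (block_of D) (isT : x \in predT)).

Lemma mem_block_pt x (B : factor_pts D) : (x \in val B) = (block_pt x == B).
Proof.
rewrite -val_eqE /=; case/imsetP: (valP B) => y _ ->.
by rewrite block_eqE eq_sym.
Qed.

Lemma block_pt_surj (B : factor_pts D) : exists x, block_pt x = B.
Proof.
case/imsetP: (valP B) => y _ By; exists y.
by apply/eqP; rewrite -mem_block_pt By block_refl.
Qed.

Lemma block_pt_eq x y : (block_pt x == block_pt y) = ((x, y) \in cover D).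
Proof. by rewrite -val_eqE /= -in_block block_eqE. Qed.

Lemma factor_relP c (B B' : factor_pts D) :
  reflect (exists x y, [/\ block_pt x = B, block_pt y = B' & (x, y) \in c])
    ((B, B') \in factor_rel D c).
Proof.
rewrite inE /=; apply: (iffP existsP) => [[x /andP [xB /existsP [y /andP [yB' xyc]]]]|].
  by exists x, y; split=> //; apply/eqP; rewrite -mem_block_pt.
case=> x [y [xB yB' xyc]]; exists x; rewrite mem_block_pt xB eqxx /=.
by apply/existsP; exists y; rewrite mem_block_pt yB' eqxx.
Qed.

Lemma factor_rel_pt c x y : (x, y) \in c -> (block_pt x, block_pt y) \in factor_rel D c.
Proof. by move=> xyc; apply/factor_relP; exists x, y. Qed.

(** The entry counts the pairs of [c] from the block of [x] to the block of [y]. As the product lies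
    in the adjacency algebra, whether it vanishes depends only on the member of [C] through (x,
    y). *)
Lemma factor_rel_J c x y :
  ((block_pt x, block_pt y) \in factor_rel D c) = (entry (J *m adjmx F c *m J) x y != 0).
Proof.
have nJ : nonneg_mx J by exact: nonneg_adjmx.
have nc : nonneg_mx (adjmx F c) by exact: nonneg_adjmx.
apply/factor_relP/(entry_mulmx_neq0 _ _ (nonneg_mulmx nJ nc) nJ).
  case=> u [v [/eqP ux /eqP vy uvc]]; exists v; split.
    apply/entry_mulmx_neq0 => //; exists u.
    by rewrite !entry_adjmx_neq0 -block_pt_eq eq_sym.
  by rewrite entry_adjmx_neq0 -block_pt_eq.
case=> v [/(entry_mulmx_neq0 _ _ nJ nc) [u []]].
rewrite !entry_adjmx_neq0 -!block_pt_eq => /eqP xu uvc /eqP vy.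
by exists u, v.
Qed.

Lemma factor_rel_sub c d p : c \in C -> d \in C ->
  p \in factor_rel D c -> p \in factor_rel D d -> factor_rel D c \subset factor_rel D d.
Proof.
case: p => B B' cC dC /factor_relP [x [y [<- <- xyc]]] xyd.
apply/subsetP => -[B1 B1'] /factor_relP [x' [y' [<- <- xyc']]].
rewrite factor_rel_J -(cc_const _ cC xyc xyc') -?factor_rel_J //.
by do 2?[apply: cc_mul]; [exact: closed_J_cc | exact: adjmx_in_span | exact: closed_J_cc].
Qed.

Lemma factor_rel_eq c d p : c \in C -> d \in C ->
  p \in factor_rel D c -> p \in factor_rel D d -> factor_rel D c = factor_rel D d.
Proof.
move=> cC dC pc pd; apply/eqP.
by rewrite eqEsubset (factor_rel_sub cC dC pc pd) (factor_rel_sub dC cC pd pc).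
Qed.

Lemma factor_rel_transp c : factor_rel D (transp c) = transp (factor_rel D c).
Proof.
apply/setP => -[B B']; rewrite [RHS]inE /=.
by apply/factor_relP/factor_relP => -[x [y [xB yB xyc]]]; exists y, x; split=> //;
  move: xyc; rewrite inE.
Qed.

Lemma factor_partition : partition (factor_cc C D) [set: factor_pts D * factor_pts D].
Proof.
apply/and3P; split.
- apply/eqP/setP => -[B B']; rewrite inE; apply/bigcupP.
  have [x <-] := block_pt_surj B; have [y <-] := block_pt_surj B'.
  have [c cC xyc] := cc_class (x, y).
  by exists (factor_rel D c); [exact: imset_f | exact: factor_rel_pt].
- apply/trivIsetP => _ _ /imsetP [c cC ->] /imsetP [d dC ->]; apply: contraR.
  case/pred0Pn => p /andP [pc pd]; apply/eqP; exact: factor_rel_eq pc pd.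
- apply/imsetP => -[c cC] /setP c0; have [x [y xyc]] := cc_nonempty cC.
  by have := factor_rel_pt xyc; rewrite -c0 inE.
Qed.

Lemma factor_trivIset : trivIset (factor_cc C D).
Proof. by case/and3P: factor_partition. Qed.

(** Inflation from blocks to points, which transports questions about the factor configuration to
    [C]. *)
Definition lift_mx (M : 'MX[F]_(factor_pts D)) : 'MX[F]_X :=
  \matrix_(i, j) entry M (block_pt (enum_val i)) (block_pt (enum_val j)).

Lemma entry_lift_mx M x y : entry (lift_mx M) x y = entry M (block_pt x) (block_pt y).
Proof. by rewrite /entry mxE !enum_rankK. Qed.

Lemma lift_mx_span M : (lift_mx M \in adj_span F C) = (M \in adj_span F (factor_cc C D)).
Proof.
apply/(adj_spanP _ cc_trivIset)/(adj_spanP _ factor_trivIset) => -[out const]; split.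
- move=> B B'; case/and3P: factor_partition => /eqP -> _ _.
  by rewrite inE.
- move=> _ /imsetP [c cC ->] B B' B1 B1'.
  move=> /factor_relP [x [y [<- <- xyc]]] /factor_relP [x' [y' [<- <- xyc']]].
  by rewrite -!entry_lift_mx (const c cC _ _ _ _ xyc xyc').
- by move=> x y; case/bigcupP; have [c cC xyc] := cc_class (x, y); exists c.
- move=> c cC x y x' y' xyc xyc'; rewrite !entry_lift_mx.
  by apply: (const (factor_rel D c)); [exact: imset_f | exact: factor_rel_pt..].
Qed.

Lemma lift_mx_mul x0 M N :
  lift_mx M *m lift_mx N = #|block_of D x0|%:R *: lift_mx (M *m N).
Proof.
apply: entryP => x y; rewrite entryZ entry_lift_mx !entry_mulmx.
rewrite (partition_big block_pt predT) //= mulr_sumr; apply: eq_bigr => B _.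
under eq_bigr => z /eqP zB do rewrite !entry_lift_mx zB.
rewrite sumr_const [RHS]mulr_natl; congr (_ *+ _).
have [z <-] := block_pt_surj B; rewrite (card_block x0 z).
by apply: eq_card => w; exact: esym (mem_block_pt w (block_pt z)).
Qed.

Lemma factor_homogeneous : homogeneous_cc F (factor_cc C D).
Proof.
have [_ trC diagC _] := hC; split; first exact: factor_partition.
- by move=> _ /imsetP [c cC ->]; rewrite -factor_rel_transp imset_f // trC.
- apply/imsetP; exists (@Defs.diagonal X) => //; apply/setP => -[B B']; rewrite inE /=.
  apply/eqP/factor_relP => [->|[x [y [<- <-]]]]; last by rewrite inE /= => /eqP ->.
  by have [x <-] := block_pt_surj B'; exists x, x; rewrite inE /=.
- move=> M N; rewrite -!lift_mx_span => MC NC.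
  have [x0 _] := cc_nonempty diagC.
  (* The block size is invertible in characteristic zero, so the lift of a product is a multiple of
     the product of the lifts. *)
  have n0 : #|block_of D x0|%:R != 0 :> F by rewrite pnatr_eq0 -lt0n block_gt0.
  rewrite -[lift_mx _]scale1r -(mulVf n0) -scalerA -lift_mx_mul.
  by apply: rpredZ; exact: cc_mul.
Qed.

End ClosedSubset.

(** * The weight *)

Section BlockMatrices.
Variables (F : numClosedFieldType) (X : finType) (C D : {set {set X * X}}).
Hypotheses (hC : homogeneous_cc F C) (hD : closed_subset F C D).
Variables (l : nat) (o : factor_pts D -> 'I_l -> X).
Hypothesis ho : block_ordering o.
Implicit Types (A M : 'MX[F]_X) (B : factor_pts D).

Lemma ordering_pt B i : block_pt D (o B i) = B.
Proof.
apply/eqP; rewrite -(mem_block_pt hC hD); have [_ <-] := ho B.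
exact: imset_f.
Qed.

Lemma ordering_surj x : exists i, o (block_pt D x) i = x.
Proof.
have : x \in val (block_pt D x) by rewrite (mem_block_pt hC hD) eqxx.
by have [_ <-] := ho (block_pt D x); case/imsetP => i _ ->; exists i; rewrite ordering_pt.
Qed.

Lemma sum_ordering (V : nmodType) (g : X -> V) : \sum_x g x = \sum_B \sum_i g (o B i).
Proof.
rewrite (partition_big (block_pt D) predT) //=; apply: eq_bigr => B _.
have [injo imo] := ho B.
transitivity (\sum_(x in [set o B i | i : 'I_l]) g x).
  by apply: eq_bigl => x; rewrite imo (mem_block_pt hC hD).
by rewrite big_imset //= => i j _ _; apply: injo.
Qed.

Lemma mxblock_mul A M B B' :
  mxblock_at o (A *m M) B B' = \sum_B1 mxblock_at o A B B1 *m mxblock_at o M B1 B'.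
Proof.
apply/matrixP => i j; rewrite mxE summxE entry_mulmx sum_ordering.
by apply: eq_bigr => B1 _; rewrite mxE; apply: eq_bigr => k _; rewrite !mxE.
Qed.

Lemma mxblock_eq A M :
  (forall B B', mxblock_at o A B B' = mxblock_at o M B B') -> A = M.
Proof.
move=> eqb; apply: entryP => x y.
have [i <-] := ordering_surj x; have [j <-] := ordering_surj y.
by have /matrixP /(_ i j) := eqb (block_pt D x) (block_pt D y); rewrite !mxE.
Qed.

Lemma mxblock_adjmx0 A B B' : A \in adj_span F D -> B != B' -> mxblock_at o A B B' = 0.
Proof.
move=> /(adj_spanP _ (closed_trivIset hC hD)) [out _] BB'.
apply/matrixP => i j; rewrite !mxE out //.
by rewrite -(block_pt_eq hC hD) !ordering_pt.
Qed.

Lemma mxblock_mull A M B B' : A \in adj_span F D ->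
  mxblock_at o (A *m M) B B' = mxblock_at o A B B *m mxblock_at o M B B'.
Proof.
move=> AD; rewrite mxblock_mul (bigD1 B) //= big1 ?addr0 // => B1 BB1.
by rewrite (mxblock_adjmx0 AD) ?mul0mx // eq_sym.
Qed.

Lemma mxblock_mulr A M B B' : A \in adj_span F D ->
  mxblock_at o (M *m A) B B' = mxblock_at o M B B' *m mxblock_at o A B' B'.
Proof.
move=> AD; rewrite mxblock_mul (bigD1 B') //= big1 ?addr0 // => B1 BB1.
by rewrite (mxblock_adjmx0 AD) ?mulmx0.
Qed.

Lemma mxblock_sum (I : finType) (P : pred I) (G : I -> 'MX[F]_X) B B' :
  mxblock_at o (\sum_(i | P i) G i) B B' = \sum_(i | P i) mxblock_at o (G i) B B'.
Proof.
apply/matrixP => i j; rewrite mxE entry_sum summxE; apply: eq_bigr => k _.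
by rewrite mxE.
Qed.

Lemma mxblockZ a A B B' : mxblock_at o (a *: A) B B' = a *: mxblock_at o A B B'.
Proof. by apply/matrixP => i j; rewrite !mxE entryZ. Qed.

Lemma std_char_mxblock A B : std_char (val B) A = \tr (mxblock_at o A B B).
Proof.
have [injo <-] := ho B; rewrite /std_char big_imset /=; last by move=> i j _ _; apply: injo.
by apply: eq_bigr => i _; rewrite mxE.
Qed.

Lemma mxblock_faithful A B i : A \in adj_span F D -> row i (mxblock_at o A B B) = 0 -> A = 0.
Proof.
move=> AD /rowP r0; apply: (closed_row_eq0 hC hD (x := o B i) AD) => y.
rewrite in_block -(block_pt_eq hC hD) ordering_pt => /eqP By.
have [j <-] := ordering_surj y; rewrite -By.
by have := r0 j; rewrite !mxE.
Qed.

Section MultiplicityOne.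
Variables (phi : 'MX[F]_X -> F) (E : 'MX[F]_X) (e : 'M[F]_l).
Hypotheses (hphi : irr_char (adj_span F D) phi) (hphi1 : irr_multiplicity D phi 1).
Hypothesis hE : central_primitive_idempotent_of (adj_span F D) phi E.
Hypothesis he : forall B, mxblock_at o E B B = e.

Let VM : mul_closed (adj_span F D). Proof. by case: hD. Qed.
Let V1 := closed_one hC hD.
Let Vadj := closed_adj hC hD.

Lemma idem_in_span : E \in adj_span F D.
Proof. by case: hE => -[[]]. Qed.

Lemma block_exists : exists B : factor_pts D, True.
Proof.
case: hC => _ _ dC _; have [x _] := cc_nonempty hC dC.
by exists (block_pt D x).
Qed.

Lemma block_idem : e *m e = e.
Proof.
have [B _] := block_exists; case: hE => -[[_ _ EE] _ _] _.
by rewrite -{1 2}(he B) -mxblock_mull ?idem_in_span // EE.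
Qed.

(** By multiplicity one the trace of [E] on a block is the degree [k], so the idempotent [e] has
    rank [k]. The row of one point embeds [E V] in the row space of [e], which is the dimension
    bound that [irr_degree1] asks for. *)
Lemma block_rank1 : \rank e = 1%N.
Proof.
have [B _] := block_exists; have [Eprim phiE] := hE; have [Ec E0 _] := Eprim.
have [EV EC EE] := Ec; have [k [rho [irr rhoP]]] := hphi.
have tre : \tr e = k%:R.
  have <- : std_char (val B) E = k%:R; last by rewrite std_char_mxblock he.
  rewrite (char_at_idempotent VM V1 Vadj Eprim hphi phiE (hphi1 (valP B))) rhoP //.
  by case: irr => -[_ _ ->] _ _; rewrite mxtrace1.
have rank_k : \rank e = k.
  apply/eqP; rewrite -(eqr_nat F) -tre -{2}(mulmx_base e) mxtrace_mulC.
  by rewrite idempotent_base ?mxtrace1 // block_idem.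
have rhoE : rho E != 0.
  case: irr => -[_ _ rho1] k_gt0 _; apply: contra_eq_neq phiE => rho0.
  by rewrite !rhoP // rho0 rho1 mxtrace0 mxtrace1 eq_sym pnatr_eq0 -lt0n.
rewrite rank_k; apply: (irr_degree1 VM V1 Eprim irr rhoE).
have [x _] := block_pt_surj hC hD B; have [i0 _] := ordering_surj x.
set U := (_ @: _)%VS.
have UV : (U <= adj_span F D)%VS by case: (right_ideal_at_limg VM Eprim).
(* [E] is central, so it also fixes [E V] from the right; this puts the rows of [P] in the row space
   of [e]. *)
have UE a : a \in U -> a *m E = a.
  move=> aU; rewrite -EC ?(subvP UV) //; case: (right_ideal_at_limg VM Eprim) => _ _; exact.
pose P := \matrix_(i < \dim U) row i0 (mxblock_at o (vbasis U)`_i B B).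
have Pe : (P <= e)%MS.
  apply/row_subP => i; rewrite rowK -{1}(UE (vbasis U)`_i); last exact: vbasis_nth_mem.
  by rewrite mxblock_mulr // he row_mul submxMl.
suff /eqP <- : row_free P by rewrite -rank_k mxrankS.
apply: inj_row_free => w w0; apply: vbasis_sum_eq0; apply: (@mxblock_faithful _ B i0).
  by apply: (subvP UV); exact: vsum_vbasis.
rewrite -[RHS]w0 mulmx_sum_row mxblock_sum linear_sum; apply: eq_bigr => i _.
by rewrite rowK mxblockZ linearZ.
Qed.

Lemma corner_scalar (M : 'M[F]_l) : e *m M *m e = \tr (e *m M *m e) *: e.
Proof. exact: rank1_corner block_idem block_rank1 M. Qed.

Lemma trace_block : \tr e = 1.
Proof.
by rewrite -{1}(mulmx_base e) mxtrace_mulC idempotent_base ?block_idem // mxtrace1 block_rank1.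
Qed.

(** It agrees with [Gamma] on corners, but is linear on all matrices. *)
Definition block_trace M : 'MX[F]_(factor_pts D) :=
  \matrix_(p, q) \tr (mxblock_at o M (enum_val p) (enum_val q)).

Lemma entry_block_trace M B B' : entry (block_trace M) B B' = \tr (mxblock_at o M B B').
Proof. by rewrite /entry mxE !enum_rankK. Qed.

Lemma block_trace_sum (I : finType) (P : pred I) (G : I -> 'MX[F]_X) :
  block_trace (\sum_(i | P i) G i) = \sum_(i | P i) block_trace (G i).
Proof.
apply: entryP => B B'; rewrite entry_sum entry_block_trace mxblock_sum linear_sum.
by apply: eq_bigr => i _; rewrite entry_block_trace.
Qed.

Lemma block_traceZ a M : block_trace (a *: M) = a *: block_trace M.
Proof.
by apply: entryP => B B'; rewrite entryZ !entry_block_trace mxblockZ linearZ.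
Qed.

Lemma block_trace0 : block_trace 0 = 0.
Proof. by have := block_traceZ 0 0; rewrite !scale0r. Qed.

Definition corner M := E *m M *m E.

Lemma mxblock_corner M B B' :
  mxblock_at o (corner M) B B' = entry (block_trace (corner M)) B B' *: e.
Proof.
rewrite entry_block_trace /corner mxblock_mulr ?idem_in_span // mxblock_mull ?idem_in_span //.
by rewrite !he; exact: corner_scalar.
Qed.

Lemma block_neq0 : e != 0.
Proof.
apply/eqP => e0; move: trace_block; rewrite e0 mxtrace0 => /esym/eqP.
by rewrite oner_eq0.
Qed.

Lemma Gamma_corner M : Gamma o e (corner M) = block_trace (corner M).
Proof.
apply: entryP => B B'; rewrite {1}/entry mxE !enum_rankK mxblock_corner.
(* The block trace shows that a scalar exists, and [e != 0] that it is unique. *)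
case: xgetP => [a -> /= /esym/eqP|/(_ (entry (block_trace (corner M)) B B'))] //=.
by rewrite -subr_eq0 -scalerBl scaler_eq0 (negPf block_neq0) orbF subr_eq0 => /eqP.
Qed.

Lemma block_trace_mul M N :
  block_trace (corner M *m corner N) = block_trace (corner M) *m block_trace (corner N).
Proof.
apply: entryP => B B'; rewrite entry_block_trace mxblock_mul linear_sum entry_mulmx.
apply: eq_bigr => B1 _; rewrite /= !mxblock_corner -scalemxAl -scalemxAr block_idem !mxtraceZ.
by rewrite trace_block mulr1.
Qed.

Lemma corner_mul M N : corner M *m corner N = corner (M *m E *m N).
Proof.
have [[[_ _ EE] _ _] _] := hE.
by rewrite /corner !mulmxA -(mulmxA (E *m M) E E) EE.
Qed.

Lemma corner_adj M : (corner M)^H = corner M^H.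
Proof.
have [Eprim _] := hE.
by rewrite /corner !mulmx_adj (primitive_self_adjoint VM Vadj Eprim) mulmxA.
Qed.

Lemma corner_neq0 M : corner M != 0 ->
  exists B B', entry (block_trace (corner M)) B B' != 0.
Proof.
move=> M0; apply/not_existsP => no; case/eqP: M0.
apply: mxblock_eq => B B'; rewrite mxblock_corner.
have -> : entry (block_trace (corner M)) B B' = 0.
  by apply/eqP; apply: contrapT => n0; apply: (no B); exists B'; apply/negP.
by rewrite scale0r; apply/matrixP => i j; rewrite !mxE /entry mxE.
Qed.

Lemma idem_in_cc : E \in adj_span F C.
Proof. exact: (subvP (closed_span hD)) _ idem_in_span. Qed.

Lemma corner_cc M : M \in adj_span F C -> corner M \in adj_span F C.
Proof. by move=> MC; do 2?apply: (cc_mul hC) => //; exact: idem_in_cc. Qed.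

(** [E] is block diagonal, so a block of the corner involves only the same block of [adjmx F c]. *)
Lemma corner_factor_rel c B B' :
  entry (block_trace (corner (adjmx F c))) B B' != 0 -> (B, B') \in factor_rel D c.
Proof.
apply: contraNT => nBB'; rewrite entry_block_trace.
rewrite /corner mxblock_mulr ?idem_in_span // mxblock_mull ?idem_in_span //.
suff -> : mxblock_at o (adjmx F c) B B' = 0 by rewrite mulmx0 mul0mx mxtrace0.
apply/matrixP => i j; rewrite !mxE entry_adjmx; case: (boolP (_ \in c)) => // ijc.
case/negP: nBB'; have := factor_rel_pt hC hD ijc.
by rewrite !ordering_pt.
Qed.

(* [t] is the ratio of two entries of [e] at positions [(i1, j1)] and [(i, j)] of the *)
(* two blocks that lie in a common member of [C], on which [E M E] is constant.     *)
Lemma corner_proportional c B B' B1 B1' : c \in C ->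
  (B, B') \in factor_rel D c -> (B1, B1') \in factor_rel D c ->
  exists t, forall M, M \in adj_span F C ->
    entry (block_trace (corner M)) B B' = t * entry (block_trace (corner M)) B1 B1'.
Proof.
move=> cC BB' BB1'.
have [i [j eij]] : exists i j, e i j != 0.
  apply/not_existsP => no; case/eqP: block_neq0; apply/matrixP => i j; rewrite mxE.
  by apply/eqP; apply: contrapT => n0; apply: (no i); exists j; apply/negP.
have [d dC xyd] := cc_class hC (o B i, o B' j).
have BBd : (B, B') \in factor_rel D d.
  by have := factor_rel_pt hC hD xyd; rewrite !ordering_pt.
(* [d] has the same factor relation as [c], so it also meets the pair of blocks [B1], [B1']. *)
rewrite (factor_rel_eq hC hD cC dC BB' BBd) in BB1'.
have [x [y [xB1 yB1' xyd']]] := factor_relP hC hD _ _ _ BB1'.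
have [i1 xi1] := ordering_surj x; have [j1 yj1] := ordering_surj y.
rewrite xB1 in xi1; rewrite yB1' in yj1; rewrite -xi1 -yj1 in xyd'.
exists (e i1 j1 / e i j) => M MC; apply: (mulIf eij).
have entE (B2 B2' : factor_pts D) k m :
    entry (block_trace (corner M)) B2 B2' * e k m = entry (corner M) (o B2 k) (o B2' m).
  by have /matrixP /(_ k m) := mxblock_corner M B2 B2'; rewrite !mxE => ->.
rewrite entE (cc_const hC (corner_cc MC) dC xyd xyd') -entE.
by rewrite mulrC [RHS]mulrC mulrA [_ * (_ / _)]mulrC divfK.
Qed.

(** * The weight conditions *)

Variables (L : finType) (c : L -> {set X * X}).
Hypothesis hc : class_representatives D C E c.

Let N i := corner (adjmx F (c i)).
Let W := \sum_i Gamma o e (N i).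

Lemma repr_in_cc i : c i \in C.
Proof. by case: hc. Qed.

Lemma repr_of_factor d : d \in factor_cc C D -> exists i, d = factor_rel D (c i).
Proof. by case: hc => _ <- _ _ /imsetP [i _ ->]; exists i. Qed.

Lemma repr_uniq i j p : p \in factor_rel D (c i) -> p \in factor_rel D (c j) -> i = j.
Proof.
move=> pi pj; case: hc => _ _ + _; apply.
exact: (factor_rel_eq hC hD (repr_in_cc i) (repr_in_cc j) pi pj).
Qed.

(** Distinct representatives have disjoint factor relations, so only the summand of [i]
    contributes. *)
Lemma entry_W i B B' : (B, B') \in factor_rel D (c i) ->
  entry W B B' = entry (block_trace (N i)) B B'.
Proof.
move=> BBi; rewrite entry_sum (bigD1 i) //= big1 ?addr0 => [|j ji]; first by rewrite Gamma_corner.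
rewrite Gamma_corner; apply/eqP; apply: contraNT ji => /corner_factor_rel BBj.
by rewrite (repr_uniq BBi BBj).
Qed.

(** By [corner_proportional], one nonzero block trace in a factor relation forces all of them to be
    nonzero. *)
Lemma entry_W_neq0 i B B' : (B, B') \in factor_rel D (c i) -> (entry W B B' != 0) = (N i != 0).
Proof.
move=> BBi; rewrite (entry_W BBi); apply/idP/idP => [|/corner_neq0 [B1 [B1' n0]]].
  by apply: contraNneq => ->; rewrite block_trace0 /entry mxE.
have [t tP] := corner_proportional (repr_in_cc i) (corner_factor_rel n0) BBi.
by apply: contraNneq n0 => n0; rewrite tP ?n0 ?mulr0 // adjmx_in_span // repr_in_cc.
Qed.

Lemma repr_corner_neq0 i b : b \in C -> factor_rel D b = factor_rel D (c i) ->
  corner (adjmx F b) != 0 -> N i != 0.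
Proof. by case: hc => _ _ _ h bC /(h _ _ bC). Qed.

Lemma factor_class B B' : exists i, (B, B') \in factor_rel D (c i).
Proof.
have /and3P [/eqP cov _ _] := factor_partition hC hD.
have /bigcupP [d /repr_of_factor [i ->] dB] : (B, B') \in cover (factor_cc C D).
  by rewrite cov inE.
by exists i.
Qed.

Lemma spt_W : spt W = cover [set factor_rel D (c i) | i in [pred i | N i != 0]].
Proof.
apply/setP => -[B B']; rewrite inE /=; have [i BBi] := factor_class B B'.
rewrite (entry_W_neq0 BBi); apply/idP/bigcupP => [Ni|[_ /imsetP [j Nj ->] BBj]].
  by exists (factor_rel D (c i)) => //; apply: imset_f.
by rewrite (repr_uniq BBi BBj).
Qed.

(** The corner of [transp (c i)] is the adjoint of [N i], hence nonzero; the choice of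
    representatives passes this on to the representative of the transposed relation. *)
Lemma spt_W_transp d : d \in factor_cc C D -> d \subset spt W -> transp d \subset spt W.
Proof.
move=> /repr_of_factor [i ->] /subsetP sW; apply/subsetP => -[B B'].
have [_ trC _ _] := hC.
rewrite inE /= => BBi; have Ni : N i != 0.
  by have := sW _ BBi; rewrite inE /= (entry_W_neq0 BBi).
have [j BBj] := factor_class B B'; rewrite inE /= (entry_W_neq0 BBj).
have tC := trC _ (repr_in_cc i).
apply: (@repr_corner_neq0 _ (transp (c i))) => //.
  apply: (@factor_rel_eq _ _ _ _ hC hD _ _ (B, B')) => //; first exact: repr_in_cc.
  by rewrite (factor_rel_transp hC hD) inE.
rewrite adjmx_transp -corner_adj; apply: contraNneq Ni => Na.
by rewrite -[N i]adjK Na; apply/eqP/matrixP => k m; rewrite !mxE conjC0.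
Qed.

(** The diagonal relation has corner [E], which is nonzero, and the representative of its factor
    relation inherits this. *)
Lemma W_diag B : entry W B B != 0.
Proof.
have [i BBi] := factor_class B B; rewrite (entry_W_neq0 BBi).
have [_ _ diagC _] := hC; have [[[_ _ EE] E0 _] _] := hE.
apply: (@repr_corner_neq0 _ (@Defs.diagonal X)) => //.
  apply: (@factor_rel_eq _ _ _ _ hC hD _ _ (B, B)) => //; first exact: repr_in_cc.
  have [x <-] := block_pt_surj hC hD B.
  by apply: (factor_rel_pt hC hD); rewrite inE.
by rewrite adjmx_diagonal /corner mulmx1 EE.
Qed.

Lemma wadjmx_W i : wadjmx W (factor_rel D (c i)) = block_trace (N i).
Proof.
apply: entryP => B B'; have -> : entry (wadjmx W (factor_rel D (c i))) B B' =
    ((B, B') \in factor_rel D (c i))%:R * entry W B B'.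
  by rewrite {1}/entry [LHS]mxE; congr (_ * _); exact: entry_adjmx.
case: (boolP (_ \in _)) => [BBi|nBB]; first by rewrite mul1r (entry_W BBi).
rewrite mul0r; apply/esym/eqP; apply: contraNT nBB; exact: corner_factor_rel.
Qed.

Lemma wadjmx_in_span i : block_trace (N i) \in wadj_span (factor_cc C D) W.
Proof.
rewrite -wadjmx_W; apply: memv_span; apply: map_f; rewrite mem_enum.
by apply: imset_f; exact: repr_in_cc.
Qed.

(** Members of [C] with one factor relation share the ratios between pairs of blocks, so their block
    traces are multiples of that of the representative. *)
Lemma block_trace_in_wspan M : M \in adj_span F C ->
  block_trace (corner M) \in wadj_span (factor_cc C D) W.
Proof.
move=> /span_enumP [a ->].
have -> : corner (\sum_(b in C) a b *: adjmx F b) = \sum_(b in C) a b *: corner (adjmx F b).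
  rewrite /corner mulmx_sumr mulmx_suml; apply: eq_bigr => b _.
  by rewrite -scalemxAr -scalemxAl.
rewrite block_trace_sum; apply: rpred_sum => b bC; rewrite block_traceZ; apply: rpredZ.
have [i bi] : exists i, factor_rel D b = factor_rel D (c i).
  by apply: repr_of_factor; exact: imset_f.
have [b0|b0] := eqVneq (corner (adjmx F b)) 0.
  by rewrite b0 block_trace0 mem0v.
have /corner_neq0 [B1 [B1' n0]] := repr_corner_neq0 bC bi b0.
have BB1 := corner_factor_rel n0.
(* The constant compares the two matrices at a pair of blocks where that of [N i] does not
   vanish. *)
suff -> : block_trace (corner (adjmx F b)) =
    (entry (block_trace (corner (adjmx F b))) B1 B1' / entry (block_trace (N i)) B1 B1')
    *: block_trace (N i) by apply: rpredZ; exact: wadjmx_in_span.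
apply: entryP => B B'; rewrite entryZ.
case: (boolP ((B, B') \in factor_rel D (c i))) => [BBi|nBB].
  have [t tP] := corner_proportional (repr_in_cc i) BBi BB1.
  rewrite !tP; try by apply: adjmx_in_span; rewrite ?repr_in_cc.
  by rewrite mulrCA divfK.
have z0 (d : {set X * X}) : factor_rel D d = factor_rel D (c i) ->
    entry (block_trace (corner (adjmx F d))) B B' = 0.
  by move=> di; apply/eqP; apply: contraNT nBB => /corner_factor_rel; rewrite di.
by rewrite !z0 // mulr0.
Qed.

Lemma weight_W : weight (factor_cc C D) W.
Proof.
split.
- exact: factor_homogeneous.
- split; last exact: spt_W_transp.
  exists [set factor_rel D (c i) | i in [pred i | N i != 0]]; last exact: spt_W.
  by apply/subsetP => _ /imsetP [i _ ->]; apply: imset_f; exact: repr_in_cc.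
- exact: W_diag.
- apply: span_mul_closed => _ _ /mapP [d + ->] /mapP [d' + ->].
  rewrite !mem_enum => /repr_of_factor [i ->] /repr_of_factor [j ->].
  (* The product of two corners is the corner of an element of the adjacency algebra of [C]. *)
  rewrite !wadjmx_W -block_trace_mul corner_mul; apply: block_trace_in_wspan.
  by do 2?[apply: (cc_mul hC)]; [exact: adjmx_in_span (repr_in_cc i) | exact: idem_in_cc
    | exact: adjmx_in_span (repr_in_cc j)].
Qed.

End MultiplicityOne.
End BlockMatrices.

Theorem theorem4p2 (R : realType) (X : finType) (C D : {set {set X * X}})
    (phi : 'MX[R[i]]_X -> R[i]) (e_phi : 'MX[R[i]]_X)
    (l : nat) (o : factor_pts D -> 'I_l -> X) (e : 'M[R[i]]_l)
    (L : finType) (c : L -> {set X * X})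
    (hC : homogeneous_cc R[i] C)
    (hD : closed_subset R[i] C D)
    (hphi : irr_char (adj_span R[i] D) phi)
    (hphi1 : irr_multiplicity D phi 1)
    (he_phi : central_primitive_idempotent_of (adj_span R[i] D) phi e_phi)
    (ho : block_ordering o)
    (he : forall B : factor_pts D, mxblock_at o e_phi B B = e)
    (hc : class_representatives D C e_phi c) :
  weight (factor_cc C D)
    (\sum_(i : L) Gamma o e (e_phi *m adjmx R[i] (c i) *m e_phi)).
Proof.
exact: (weight_W hC hD ho hphi hphi1 he_phi he hc).
Qed.
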